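(* Let $G_1=(V_1,E_1)$ and $G_2=(V_2,E_2)$ be simple connected graphs with $V_1\cap V_2=\emptyset$, let $x\in V_1$, $y\in V_2$, $e=\{x,y\}$, and let $G=(V_1\cup V_2,E_1\cup E_2\cup\{e\})$. Then $$\beta_1(\mathbb{K}[G])=\beta_1(\mathbb{K}[G/e]).$$
   Context: For a finite simple graph $H=(V,E)$, the toric ideal $I_H\subseteq\mathbb{K}[E]$ is the kernel of the $\mathbb{K}$-algebra map $\mathbb{K}[E]\to\mathbb{K}[V]$ sending an edge $\{u,v\}$ to $uv$; $\mathbb{K}[H]=\mathbb{K}[E]/I_H$ (standard graded), and $\beta_i(\mathbb{K}[H])$ denotes its $i$-th total Betti number over $\mathbb{K}[E]$ (so $\beta_1$ is the number of minimal generators of $I_H$). Contraction of an edge $e=\{x,y\}$ of $H$: with a new vertex $y_0$, $V'=(V\cup\{y_0\})\setminus\{x,y\}$, $\chi:V\to V'$ the identity on $V\setminus\{x,y\}$ sending $x,y$ to $y_0$, $E'=\{\{\chi(u),\chi(u')\}:\{u,u'\}\in E\setminus\{e\}\}$ (repetitions ignored), and $H/e=(V',E')$. *)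

(* Defs.v *)
From HB Require Import structures.
From mathcomp Require Import all_boot all_order all_algebra.
From mathcomp Require Import mpoly.
From Stdlib Require Import ClassicalEpsilon.

Set Implicit Arguments.
Unset Strict Implicit.
Unset Printing Implicit Defensive.

Import GRing.Theory.
Local Open Scope ring_scope.

Section Graphs.
Variable T : finType.

Definition simple_graph (V : {set T}) (E : {set {set T}}) : Prop :=
  forall f, f \in E -> exists u v, [/\ u != v, u \in V, v \in V & f = [set u; v]].

Definition adj (E : {set {set T}}) : rel T := fun u v => [set u; v] \in E.

Definition connected (V : {set T}) (E : {set {set T}}) : Prop :=
  forall u v, u \in V -> v \in V -> connect (adj E) u v.

(* Contraction of the edge e = {x, y}: the new vertex y0 is [None],
   chi is the identity (Some) on V \ {x,y} and sends x, y to y0. *)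
Definition chi (e : {set T}) (u : T) : option T :=
  if u \in e then None else Some u.

Definition contr_V (V : {set T}) (e : {set T}) : {set option T} :=
  None |: [set Some u | u in V :\: e].

Definition contr_E (E : {set {set T}}) (e : {set T}) : {set {set option T}} :=
  [set (chi e) @: f | f : {set T} in E :\ e].

End Graphs.

Section Toric.
Variable K : fieldType.
Variable T : finType.

Definition edge_monomial (E : {set {set T}}) (i : 'I_#|E|) : {mpoly K[#|T|]} :=
  \prod_(v in enum_val i) 'X_(enum_rank v).

Definition toric_map (E : {set {set T}}) (p : {mpoly K[#|E|]}) : {mpoly K[#|T|]} :=
  comp_mpoly [tuple edge_monomial i | i < #|E|] p.

Definition toric_ideal (E : {set {set T}}) : pred {mpoly K[#|E|]} :=
  fun p => toric_map p == 0.
End Toric.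

Section Generators.
Variable K : fieldType.
Variable n : nat.

Definition generates (I : pred {mpoly K[n]}) (S : seq {mpoly K[n]}) : Prop :=
  forall p, I p <-> exists c : 'I_(size S) -> {mpoly K[n]},
      p = \sum_(i < size S) c i * S`_i.

Definition is_mu (I : pred {mpoly K[n]}) (m : nat) : Prop :=
  (exists S, generates I S /\ size S = m) /\
  (forall S, generates I S -> (m <= size S)%N).

(* mu(I): the minimal number of generators (well defined by Hilbert's basis theorem). *)
Definition mu (I : pred {mpoly K[n]}) : nat :=
  epsilon (inhabits 0%N) (is_mu I).
End Generators.

Definition beta1 (K : fieldType) (T : finType) (E : {set {set T}}) : nat :=
  mu (@toric_ideal K T E).

(* Main.v *)
Require Import Defs.
From HB Require Import structures.
From mathcomp Require Import all_boot all_order all_algebra.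
From mathcomp Require Import mpoly.
From mathcomp Require Import zify.
From Stdlib Require Import Classical ClassicalEpsilon.
From Stdlib Require Import FunctionalExtensionality PropExtensionality.

(* Call two monomials of the same degree connected if they are linked by a
   chain of monomials of that degree in which neighbours share a variable.  A
   toric ideal has [m] generators iff [m] pairs of monomials of equal degree
   suffice to link all the connected classes in every degree: generators bound
   the number of independent links, because a functional that is constant on
   connected classes kills the product of the ideal with the irrelevant ideal.

   A monomial of [G] is a triple [(u1, u2, k)] with [u1] on [E1], [u2] on [E2]
   and [k] the exponent of the bridge; a monomial of [G/e] is a pair [(u1, u2)].
   Exchanging the [E2] parts of the two members of a pair,
     (p1, p2, k), (q1, q2, l)  |->  (p1, q2), (q1, p2),
   preserves equality of degrees, and is inverted by restoring bridge exponents
   from the degrees at [x].  It carries linking families to linking families: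
   in a degree that mixes both sides, the class of a monomial depends only on
   the degree at [x] of its [E1] part, and by cutting alternating walks at [x]
   two monomials for which these degrees differ by more than 2 are connected. *)

Set Implicit Arguments.
Unset Strict Implicit.
Unset Printing Implicit Defensive.

Import GRing.Theory.
Local Open Scope ring_scope.

(** * Generators of toric ideals and connectedness of fibers *)

Section LinearExtension.
Variables (K : fieldType) (n : nat) (V : lmodType K).
Implicit Types (f : 'X_{1..n} -> V) (p q : {mpoly K[n]}).

Definition lext f p : V := \sum_(m <- msupp p) p@_m *: f m.

Lemma lext_seq f p (s : seq 'X_{1..n}) :
  uniq s -> {subset msupp p <= s} -> lext f p = \sum_(m <- s) p@_m *: f m.
Proof.
move=> us sub; rewrite (bigID (mem (msupp p))) /= [X in _ + X]big1 ?addr0; last first.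
  by move=> m /memN_msupp_eq0 ->; rewrite scale0r.
rewrite -big_filter; apply: perm_big; apply: uniq_perm.
- exact: msupp_uniq.
- exact: filter_uniq.
by move=> m; rewrite mem_filter; case: (boolP (m \in msupp p)) => //= /sub ->.
Qed.

Fact lext_linear f : linear (lext f).
Proof.
(* Additivity needs one list of monomials covering the three supports; [lext_seq] lets each sum run
   over it. *)
move=> c p q; set s := undup (msupp (c *: p + q) ++ msupp p ++ msupp q).
have us : uniq s by apply: undup_uniq.
have memE r m : m \in msupp r -> r \in [:: c *: p + q; p; q] -> m \in s.
  by move=> mr; rewrite !inE mem_undup !mem_cat => /or3P[] /eqP <-;
    rewrite mr ?orbT.
rewrite !(@lext_seq f _ s us) => [|m /memE|m /memE|m /memE];
  try by apply; rewrite !inE eqxx ?orbT.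
rewrite scaler_sumr -big_split /=; apply: eq_bigr => m _.
by rewrite mcoeffD mcoeffZ scalerDl scalerA.
Qed.

HB.instance Definition _ f :=
  GRing.isLinear.Build K {mpoly K[n]} V _ (lext f) (lext_linear f).

Lemma lextX f m : lext f 'X_[m] = f m.
Proof. by rewrite /lext msuppX big_seq1 mcoeffX eqxx scale1r. Qed.

Lemma linear_lextE (L : {mpoly K[n]} -> V) p :
  linear L -> L p = lext (fun m => L 'X_[m]) p.
Proof.
move=> linL.
pose L' : {linear _ -> _} := HB.pack L (GRing.isLinear.Build K _ V *:%R L linL).
rewrite -[LHS]/(L' p) {1}(mpolyE p) raddf_sum; apply: eq_bigr => m _.
exact: (linearZ_LR L').
Qed.

Lemma eq_lext f g p : f =1 g -> lext f p = lext g p.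
Proof. by move=> fg; apply: eq_bigr => m _; rewrite fg. Qed.

End LinearExtension.

(** * Closure properties of the ideal generated by a list *)

Section IdealOfList.
Variables (K : fieldType) (n : nat).
Implicit Types (S : seq {mpoly K[n]}) (p q : {mpoly K[n]}).

Definition in_ideal S p :=
  exists c : 'I_(size S) -> {mpoly K[n]}, p = \sum_(i < size S) c i * S`_i.

Lemma in_ideal0 S : in_ideal S 0.
Proof. by exists (fun=> 0); rewrite big1 // => i _; rewrite mul0r. Qed.

Lemma in_idealD S p q : in_ideal S p -> in_ideal S q -> in_ideal S (p + q).
Proof.
case=> c -> [d ->]; exists (fun i => c i + d i).
by rewrite -big_split; apply: eq_bigr => i _; rewrite mulrDl.
Qed.

Lemma in_idealM S p q : in_ideal S q -> in_ideal S (p * q).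
Proof.
case=> c ->; exists (fun i => p * c i).
by rewrite mulr_sumr; apply: eq_bigr => i _; rewrite mulrA.
Qed.

Lemma in_idealN S p : in_ideal S p -> in_ideal S (- p).
Proof. by rewrite -mulN1r; apply: in_idealM. Qed.

Lemma in_ideal_mem S p : p \in S -> in_ideal S p.
Proof.
move=> pS; have iS : (index p S < size S)%N by rewrite index_mem.
exists (fun i => (i == Ordinal iS)%:R).
rewrite (bigD1 (Ordinal iS)) //= eqxx mul1r nth_index // big1 ?addr0 //.
by move=> i /negbTE ->; rewrite mul0r.
Qed.

Lemma in_ideal_sum S (I : eqType) (r : seq I) (F : I -> {mpoly K[n]}) :
  (forall i, i \in r -> in_ideal S (F i)) -> in_ideal S (\sum_(i <- r) F i).
Proof.
move=> H; rewrite big_seq; apply: big_ind => //.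
  exact: in_ideal0.
exact: in_idealD.
Qed.

End IdealOfList.

(** * Connectedness under abstract links *)

Section Connectivity.
Variable X : eqType.
Implicit Types (eqdeg share : X -> X -> Prop) (P Q : seq (X * X)).

(** Kept abstract in the type and in both relations so as to serve exponent vectors, triples and
    pairs alike. The links from [P] carry no degree condition here; [span_by] imposes it. *)
Inductive conn eqdeg share P : X -> X -> Prop :=
| conn_share u v : eqdeg u v -> share u v -> conn eqdeg share P u v
| conn_mem u v : (u, v) \in P -> conn eqdeg share P u v
| conn_refl u : conn eqdeg share P u u
| conn_sym u v : conn eqdeg share P u v -> conn eqdeg share P v u
| conn_trans u v w : conn eqdeg share P u v -> conn eqdeg share P v w -> conn eqdeg share P u w.

Definition span_by eqdeg share m := exists P,
  [/\ size P = m, forall q, q \in P -> eqdeg q.1 q.2 &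
      forall u v, eqdeg u v -> conn eqdeg share P u v].

Lemma conn_sub eqdeg share P Q u v :
  {subset P <= Q} -> conn eqdeg share P u v -> conn eqdeg share Q u v.
Proof.
by move=> sPQ; elim=> {u v}; eauto using conn.
Qed.

Lemma conn_eqd eqdeg share P u v :
  (forall a, eqdeg a a) -> (forall a b, eqdeg a b -> eqdeg b a) ->
  (forall b a c, eqdeg a b -> eqdeg b c -> eqdeg a c) ->
  (forall q, q \in P -> eqdeg q.1 q.2) ->
  conn eqdeg share P u v -> eqdeg u v.
Proof. by move=> r s t HP; elim=> {u v} // [u v /HP|u v _ /s|u v w _ /t H _ /H]. Qed.

End Connectivity.

Arguments conn_trans {X eqdeg share P u} v {w}.

(** * Kernels of monomial maps: generators versus linking pairs *)

Section MonomialMap.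
Variables (K : fieldType) (n N : nat) (a : 'I_n -> 'X_{1..N}).
Implicit Types (u v w : 'X_{1..n}) (p : {mpoly K[n]}).

Definition mexp u : 'X_{1..N} := (\sum_(i < n) a i *+ u i)%MM.

Lemma mexpD u v : mexp (u + v)%MM = (mexp u + mexp v)%MM.
Proof.
rewrite /mexp -big_split /=; apply: eq_bigr => i _.
by apply/mnmP => j; rewrite !(mnmDE, mulmnE) mulnDr.
Qed.

Definition mker : pred {mpoly K[n]} :=
  fun p => comp_mpoly [tuple 'X_[a i] | i < n] p == 0.

Lemma comp_mexp u :
  comp_mpoly [tuple 'X_[a i] | i < n] 'X_[u] = 'X_[mexp u] :> {mpoly K[N]}.
Proof.
rewrite comp_mpolyX /mexp (big_morph _ (@mpolyXD N K) (mpolyX0 N K)).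
apply: eq_bigr => i _.
by rewrite tnth_mktuple mpolyXn.
Qed.

(** A functional that sees a monomial only through its multidegree factors through the monomial map,
    so it vanishes on the kernel. *)
Lemma mkerP p (V : lmodType K) (g : 'X_{1..N} -> V) :
  mker p -> lext (fun u => g (mexp u)) p = 0.
Proof.
move=> /eqP Ip.
have -> : lext (fun u => g (mexp u)) p
    = lext g (comp_mpoly [tuple 'X_[a i] | i < n] p).
  rewrite [RHS](@linear_lextE _ _ _ (lext g \o comp_mpoly [tuple 'X_[a i] | i < n])) /=;
    last exact: linearP.
  by apply: eq_lext => u; rewrite comp_mexp lextX.
by rewrite Ip raddf0.
Qed.

Definition eqdeg u v := mexp u = mexp v.
Definition share u v := exists i, (0 < u i)%N /\ (0 < v i)%N.

Local Notation conn := (conn eqdeg share).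

Lemma conn_mexp P u v : (forall q, q \in P -> eqdeg q.1 q.2) -> conn P u v -> eqdeg u v.
Proof. by apply: conn_eqd; rewrite /eqdeg; [| move=> ? ? -> | move=> ? ? ? -> ->]. Qed.

(** For a nontrivial monomial [m], the products of [m] with two monomials of equal degree share a
    variable of [m], so [f] takes the same value on them. Hence [f] after multiplication by [m]
    depends on the degree only and kills the kernel by [mkerP]; only the constant term of [c]
    survives. *)
Lemma lext_mulr (f : 'X_{1..n} -> K^o) c p :
  (forall u v, eqdeg u v -> share u v -> f u = f v) ->
  mker p -> lext f (c * p) = c@_0 *: lext f p.
Proof.
move=> fsh Ip.
have key m : m != 0%MM -> lext f ('X_[m] * p) = 0.
  move=> m0.
  have [i mi] : exists i, (0 < m i)%N.
    apply/existsP; apply: contraR m0 => /existsPn H; apply/eqP/mnmP => i.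
    by rewrite mnm0E; apply/eqP; rewrite -leqn0 leqNgt.
  (* [g] evaluates at a chosen monomial of multidegree [b]; the value 0 is for degrees that no
     monomial attains. *)
  pose g (b : 'X_{1..N}) : K^o :=
    match excluded_middle_informative (exists u, mexp u = b) with
    | left e => f (m + proj1_sig (constructive_indefinite_description _ e))%MM
    | right _ => 0
    end.
  have -> : lext f ('X_[m] * p) = lext (fun u => g (mexp u)) p.
    rewrite [LHS](@linear_lextE _ _ _ (fun r => lext f ('X_[m] * r))); last first.
      by move=> k r s; rewrite mulrDr -scalerAr linearP.
    apply: eq_lext => u /=.
    rewrite -mpolyXD lextX /g; case: excluded_middle_informative => [e|[]]; last by exists u.
    case: constructive_indefinite_description => v /= vu; apply: fsh.
      by rewrite /eqdeg !mexpD vu.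
    by exists i; rewrite !mnmDE !ltn_addr.
  exact: mkerP.
rewrite [LHS](@linear_lextE _ _ _ (fun r => lext f (r * p))) /=; last first.
  by move=> k r s; rewrite mulrDl -scalerAl linearP.
have -> : c@_0 *: lext f p = lext (fun m => (m == 0%MM)%:R *: lext f p) c.
  rewrite /lext -/(lext f p); under eq_bigr => m _ do rewrite scalerA.
  rewrite -scaler_suml; congr (_ *: _).
  have [c0|c0] := boolP (0%MM \in msupp c).
    rewrite (bigD1_seq 0%MM) //= eqxx mulr1 big1 ?addr0 //.
    by move=> m /negbTE ->; rewrite mulr0.
  rewrite memN_msupp_eq0 // big_seq big1 // => m mc.
  have [m0|_] := eqVneq m 0%MM; last by rewrite mulr0.
  by rewrite -m0 mc in c0.
apply: eq_lext => m /=; case: eqP => [->|/eqP/key ->].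
  by rewrite mpolyX0 mul1r scale1r.
by rewrite scale0r.
Qed.

(** Lists of independent links: each pair joins two classes that the pairs behind it in the list
    leave apart. *)
Inductive forest : seq ('X_{1..n} * 'X_{1..n}) -> Prop :=
| forest_nil : forest [::]
| forest_cons q P : forest P -> eqdeg q.1 q.2 -> ~ conn P q.1 q.2 -> forest (q :: P).

Lemma forest_eqd P : forest P -> forall q, q \in P -> eqdeg q.1 q.2.
Proof.
by elim=> {P} [//|q P _ IH Eq _] r; rewrite inE => /predU1P[-> //|/IH].
Qed.

Lemma forest_nth P i q0 : forest P -> (i < size P)%N ->
  let q := nth q0 P i in eqdeg q.1 q.2 /\ ~ conn (drop i.+1 P) q.1 q.2.
Proof.
move=> F; elim: F i => {P} [//|q P F IH Eq Cq] [|i] /=; first by rewrite drop0.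
by rewrite ltnS => /IH.
Qed.

Lemma binomial_mker u v : eqdeg u v -> mker ('X_[u] - 'X_[v]).
Proof. by move=> uv; rewrite /mker raddfB /= !comp_mexp uv subrr. Qed.

(* Testing against the indicator functions of the successive connected
   classes gives a triangular matrix of rank at most the size of [S]. *)
Lemma forest_size S P : generates mker S -> forest P -> (size P <= size S)%N.
Proof.
move=> gS FP; set l := size P; pose q0 := (0%MM, 0%MM) : 'X_{1..n} * 'X_{1..n}.
pose q (i : 'I_l) := nth q0 P i.
(* The indicator of the class of the second member of [q i], where only the pairs after position [i]
   count as links. *)
pose f (i : 'I_l) u : K^o :=
  match excluded_middle_informative (conn (drop i.+1 P) (q i).2 u) with
  | left _ => 1 | right _ => 0 end.
have fE (i : 'I_l) u v : conn (drop i.+1 P) u v -> f i u = f i v.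
  move=> uv; rewrite /f.
  case: excluded_middle_informative => [c1|c1];
    case: excluded_middle_informative => // c2.
    by case: c2; apply: conn_trans uv.
  by case: c1; apply: conn_trans c2 _; apply: conn_sym.
have fsh (i : 'I_l) u v : eqdeg u v -> share u v -> f i u = f i v.
  by move=> uv suv; apply: fE; apply: conn_share.
have qP (i : 'I_l) : eqdeg (q i).1 (q i).2 /\ ~ conn (drop i.+1 P) (q i).1 (q i).2.
  exact: forest_nth.
have SI (s : 'I_(size S)) : mker S`_s.
  by apply/gS; apply: in_ideal_mem; apply: mem_nth.
have /fin_all_exists[c cE] j : exists c : 'I_(size S) -> {mpoly K[n]},
    'X_[(q j).1] - 'X_[(q j).2] = \sum_(s < size S) c s * S`_s.
  by apply/gS; apply: binomial_mker; case: (qP j).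
pose A : 'M[K]_l := \matrix_(i, j) lext (f i) ('X_[(q j).1] - 'X_[(q j).2]).
(* By [lext_mulr] the test matrix factors through a space of dimension [size S], which bounds its
   rank. *)
have AE : A = (\matrix_(i < l, s < size S) lext (f i) S`_s : 'M[K]_(l, size S)) *m
              (\matrix_(s < size S, j < l) (c j s)@_0).
  apply/matrixP => i j; rewrite !mxE cE raddf_sum /=; apply: eq_bigr => s _.
  by rewrite (lext_mulr _ (@fsh i) (SI s)) !mxE mulrC.
have Aval i j : A i j = f i (q j).1 - f i (q j).2.
  by rewrite mxE raddfB /= !lextX.
(* For [i < j] the pair [q j] is itself a link among those used by [f i], so both of its members get
   the same value. *)
have Atrig : is_trig_mx A.
  apply/is_trig_mxP => i j ij; rewrite Aval; apply/eqP; rewrite subr_eq0; apply/eqP.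
  apply: fE; apply: conn_mem; rewrite -surjective_pairing.
  have -> : q j = nth q0 (drop i.+1 P) (j - i.+1) by rewrite nth_drop subnKC.
  by rewrite mem_nth // size_drop ltn_sub2r // (leq_ltn_trans ij).
have Aunit : A \in unitmx.
  (* Each diagonal entry is 0 - 1: the first member of [q i] lies outside the class of the
     second. *)
  rewrite unitmxE det_trig // unitfE; apply/prodf_neq0 => i _; rewrite Aval /f.
  case: excluded_middle_informative => [c1|_]; first by case: (qP i) => _ []; apply: conn_sym.
  case: excluded_middle_informative => [_|[]]; last exact: conn_refl.
  by rewrite sub0r oppr_eq0 oner_eq0.
have := mxrank_unit Aunit; rewrite AE => rk.
have: (l <= size S)%N by rewrite -[l in (l <= _)%N]rk (leq_trans (mxrankM_maxl _ _)) ?rank_leq_col.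
by [].
Qed.

(** A forest that cannot be extended already links everything, and [forest_size] stops the extension
    after at most [size S] pairs. *)
Lemma generates_span S : generates mker S -> span_by eqdeg share (size S).
Proof.
move=> gS.
have step k P : forest P -> (size P + k = size S)%N ->
    exists Q, [/\ forest Q, (size Q <= size S)%N & forall u v, eqdeg u v -> conn Q u v].
  have next P' : forest P' -> (forall u v, eqdeg u v -> conn P' u v) \/
      exists q, forest (q :: P').
    move=> FP'; have [|no] := classic (exists q, forest (q :: P')); [by right|left].
    move=> u v uv; apply: NNPP => nuv; apply: no; exists (u, v).
    exact: forest_cons.
  elim: k P => [|k IH] P FP Pk; have [HP|[q Fq]] := next P FP.
  - by exists P; split=> //; apply: forest_size.
  - by have := forest_size gS Fq; rewrite /= -Pk addn0 ltnn.
  - by exists P; split=> //; apply: forest_size.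
  - by apply: (IH (q :: P)); rewrite // -Pk addnS.
have [Q [FQ sQ HQ]] := step (size S) [::] forest_nil (add0n _).
(* Trivial pairs fill the list up to exactly [size S] entries. *)
exists (Q ++ nseq (size S - size Q) (0%MM, 0%MM)); split.
- by rewrite size_cat size_nseq subnKC.
- move=> q; rewrite mem_cat => /orP[/(forest_eqd FQ) //|].
  by rewrite mem_nseq => /andP[_ /eqP ->].
- move=> u v /HQ; apply: conn_sub => r rQ; by rewrite mem_cat rQ.
Qed.

Hypothesis a_neq0 : forall i, a i != 0%MM.

(** The binomials of the linking pairs generate. Every kernel element is a combination of binomials
    of equal degree, and such a binomial telescopes along a chain; a link sharing a variable is that
    variable times a binomial of smaller degree, as [a_neq0] makes every variable have positive
    degree. *)
Lemma span_generates m : span_by eqdeg share m ->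
  exists S : seq {mpoly K[n]}, generates mker S /\ size S = m.
Proof.
case=> P [sP eP HP].
pose S : seq {mpoly K[n]} := [seq 'X_[q.1] - 'X_[q.2] | q <- P].
exists S; split; last by rewrite size_map.
(* The outer induction is on a strict bound for the total degree of the image, the inner one on the
   chain from [u] to [v]. *)
have bin k u v : eqdeg u v -> (mdeg (mexp u) < k)%N -> in_ideal S ('X_[u] - 'X_[v]).
  elim: k u v => // k IH u v /HP; elim=> {u v}.
  - move=> u v uv [i [ui vi]]; rewrite ltnS => du.
    have split1 w : (0 < w i)%N -> w = (U_(i) + (w - U_(i)))%MM.
      by move=> wi; rewrite addmC submK // lep1mP -lt0n.
    have E1 : mexp U_(i)%MM = a i.
      rewrite /mexp (bigD1 i) //= mnm1E eqxx mulm1n big1 ?addm0 // => j ji.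
      by rewrite mnm1E eq_sym (negbTE ji) mulm0n.
    rewrite (split1 u ui) (split1 v vi) !mpolyXD -mulrBr.
    apply/in_idealM/IH.
      move: uv; rewrite /eqdeg {1}(split1 u ui) {1}(split1 v vi) !mexpD.
      exact: addmI.
    apply: leq_trans du; rewrite [in X in (_ < mdeg X)%N](split1 u ui) mexpD mdegD E1.
    by rewrite -[X in (X < _)%N]add0n ltn_add2r lt0n mdeg_eq0.
  - move=> u v uv _; apply: in_ideal_mem; exact: (map_f (fun q => 'X_[q.1] - 'X_[q.2]) uv).
  - by move=> u _; rewrite subrr; apply: in_ideal0.
  - by move=> u v uv H; rewrite -(conn_mexp eP uv) => /H/in_idealN; rewrite opprB.
  - move=> u v w uv H1 vw H2 du; rewrite -(subrKA 'X_[v]); apply: in_idealD.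
      exact: H1.
    by apply: H2; rewrite -(conn_mexp eP uv).
move=> p; split=> [Ip|[c ->]]; last first.
  rewrite /mker raddf_sum /= big1 // => i _.
  have /mapP[q qP ->] : S`_i \in S by apply: mem_nth.
  by rewrite rmorphM /= (eqP (binomial_mker (eP _ qP))) mulr0.
(* One representative in the support of [p] for each multidegree. Replacing every monomial of [p] by
   its representative gives 0 by [mkerP], so subtracting that sum leaves [p] unchanged. *)
pose rep (b : 'X_{1..N}) : 'X_{1..n} := nth 0%MM [seq u <- msupp p | mexp u == b] 0.
have repE u : u \in msupp p -> eqdeg u (rep (mexp u)).
  move=> up; rewrite /eqdeg /rep; set s := filter _ _.
  have: nth 0%MM s 0 \in s.
    apply: mem_nth; rewrite size_filter -has_count; apply/hasP; by exists u.
  by rewrite mem_filter => /andP[/eqP ->].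
have -> : p = \sum_(u <- msupp p) p@_u *: ('X_[u] - 'X_[rep (mexp u)]).
  under eq_bigr => u _ do rewrite scalerBr.
  rewrite sumrB -mpolyE.
  have := @mkerP p {mpoly K[n]} (fun b => 'X_[rep b]) Ip.
  by rewrite /lext => ->; rewrite subr0.
apply: in_ideal_sum => u up; rewrite -mul_mpolyC; apply: in_idealM.
exact: (bin (mdeg (mexp u)).+1 _ _ (repE u up)).
Qed.

Lemma generates_spanP m :
  (exists S, generates mker S /\ size S = m) <-> span_by eqdeg share m.
Proof.
split; last exact: span_generates.
by case=> S [gS <-]; apply: generates_span.
Qed.

End MonomialMap.

(** [mu] depends only on which lengths of generating lists occur, so ideals of different polynomial
    rings can be compared. *)
Lemma eq_mu (K : fieldType) (n n' : nat) (I : pred {mpoly K[n]}) (I' : pred {mpoly K[n']}) :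
  (forall m, (exists S, generates I S /\ size S = m) <->
             (exists S, generates I' S /\ size S = m)) ->
  mu I = mu I'.
Proof.
move=> H; rewrite /mu; congr (epsilon _ _).
apply: functional_extensionality => m; apply: propositional_extensionality.
have half k k' (J : pred {mpoly K[k]}) (J' : pred {mpoly K[k']}) :
  (forall m, (exists S, generates J S /\ size S = m) <->
             (exists S, generates J' S /\ size S = m)) ->
  is_mu J m -> is_mu J' m.
  move=> JJ [gJ min]; split=> [|S gS]; first exact/JJ.
  have [_ /(_ (ex_intro _ S (conj gS erefl)))[S' [gS' <-]]] := JJ (size S).
  exact: min.
by split; apply: half => // k; split=> /H.
Qed.

(** * Exchanging edges along alternating walks *)

Section EdgeMonomials.
Local Open Scope nat_scope.
Variables (T : finType) (E : {set {set T}}) (x : T).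
Implicit Types (u v p q : 'X_{1..#|E|}) (w z t : T).

Definition edeg u z := \sum_(i < #|E|) u i * (z \in enum_val i).

(** The entry at [x] is set to 0, so that equality of these functions means equal degrees at all
    vertices except [x]. *)
Definition offdeg u : {ffun T -> nat} :=
  [ffun z => if z == x then 0 else edeg u z].

Lemma edegD u v z : edeg (u + v)%MM z = edeg u z + edeg v z.
Proof. by rewrite -big_split; apply: eq_bigr => i _; rewrite mnmDE mulnDl. Qed.

Lemma edeg0 z : edeg 0%MM z = 0.
Proof. by rewrite /edeg big1 // => i _; rewrite mnm0E. Qed.

Lemma edegU i z : edeg U_(i)%MM z = (z \in enum_val i).
Proof.
rewrite /edeg (bigD1 i) //= mnm1E eqxx mul1n big1 ?addn0 // => j.
by rewrite mnm1E eq_sym => /negbTE ->.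
Qed.

Lemma edeg_gt0 u z : 0 < edeg u z -> exists i, 0 < u i /\ z \in enum_val i.
Proof.
rewrite lt0n sum_nat_eq0 negb_forall => /existsP[i].
by rewrite implyTb muln_eq0 negb_or -lt0n eqb0 negbK => /andP[]; exists i.
Qed.

Lemma offdegP u v : (forall z, z != x -> edeg u z = edeg v z) <-> offdeg u = offdeg v.
Proof.
split=> [H|/ffunP H z zx].
  by apply/ffunP => z; rewrite !ffunE; case: eqP => // /eqP /H.
by have := H z; rewrite !ffunE (negbTE zx).
Qed.

Hypothesis simpleE : forall f, f \in E -> exists a b, a != b /\ f = [set a; b].

Lemma edge_end (i : 'I_#|E|) z : z \in enum_val i ->
  exists2 t, t != z & forall w, (w \in enum_val i) = (w == z) + (w == t) :> nat.
Proof.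
have [a [b [ab ->]]] := simpleE (enum_valP i); rewrite !inE.
case/orP=> /eqP ->; [exists b | exists a]; rewrite // 1?eq_sym // => w;
  by rewrite !inE; have [->|_] := eqVneq w a; rewrite ?(negbTE ab) ?addn0.
Qed.

Lemma sum_edeg u : \sum_z edeg u z = (mdeg u).*2.
Proof.
rewrite exchange_big mdegE -muln2 big_distrl /=; apply: eq_bigr => i _.
rewrite -big_distrr; congr (_ * _) => /=; rewrite -big_mkcond sum1_card.
by have [a [b [ab ->]]] := simpleE (enum_valP i); rewrite cards2 ab.
Qed.

(** The degrees of a monomial sum to an even number, so those away from [x] fix the parity at
    [x]. *)
Lemma odd_offdeg u v : offdeg u = offdeg v -> odd (edeg u x) = odd (edeg v x).
Proof.
move/offdegP=> uv; have := sum_edeg u; have := sum_edeg v.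
rewrite (bigD1 x) // [\sum_z edeg u z](bigD1 x) //=.
have -> : \sum_(z | z != x) edeg u z = \sum_(z | z != x) edeg v z by exact: eq_bigr.
lia.
Qed.

(** Every edge has an end other than [x], where its exponent would be seen. *)
Lemma offdeg_eq0 u : offdeg u = offdeg 0%MM -> u = 0%MM.
Proof.
move/offdegP=> H; apply/mnmP => i; rewrite mnm0E; apply/eqP/negPn/negP.
rewrite -lt0n => ui.
have [a [b [ab iE]]] := simpleE (enum_valP i).
have [t ti tx] : exists2 t, t \in enum_val i & t != x.
  rewrite iE; have [ax|ax] := eqVneq a x; last by exists a; rewrite ?inE ?eqxx.
  by exists b; rewrite ?inE ?eqxx ?orbT // -ax eq_sym.
have := H t tx; rewrite edeg0 /edeg (bigD1 i) //= ti muln1.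
by move/eqP; rewrite addn_eq0 -leqn0 leqNgt ui.
Qed.

(* An alternating walk started at [x] with an edge of [u] and ending at [z]
   has consumed the edges [u'] of [u] and [v'] of [v]; it can be extended
   until it comes back to [x] along an edge of [u]. *)
Lemma alternating_walk u v n : offdeg u = offdeg v -> edeg v x < edeg u x ->
  forall u' u'' v' v'' z,
  u = (u' + u'')%MM -> v = (v' + v'')%MM -> mdeg u'' + mdeg v'' < n ->
  (forall w, edeg u' w = edeg v' w + (w == x) + (w == z)) \/
  (forall w, edeg u' w + (w == z) = edeg v' w + (w == x)) ->
  exists p p' q q', [/\ u = (p + p')%MM, v = (q + q')%MM &
    forall w, edeg p w = edeg q w + (w == x).*2].
Proof.
move=> /offdegP uv dx; elim: n => // n IH u' u'' v' v'' z Eu Ev lt_n.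
have pick m : 0 < edeg m z -> exists i t, [/\ t != z, m = (U_(i) + (m - U_(i)))%MM
    & forall w, edeg U_(i)%MM w = (w == z) + (w == t)].
  case/edeg_gt0=> i [mi /edge_end[t tz it]]; exists i, t; split=> //.
    by rewrite addmC submK // lep1mP -lt0n.
  by move=> w; rewrite edegU it.
have Eduv w : w != x -> edeg u' w + edeg u'' w = edeg v' w + edeg v'' w.
  by move=> wx; rewrite -!edegD -Eu -Ev; apply: uv.
(* Here the last edge came from [u]. At [x] the walk stops; elsewhere [u] and [v] have equal degree
   at [z], which leaves an edge of [v''] there. *)
case=> inv.
  have [zx|zx] := eqVneq z x.
    exists u', u'', v', v''; split=> // w; rewrite inv zx; lia.
  have /pick[i [t [tz Ei Ui]]] : 0 < edeg v'' z.
    by have := Eduv z zx; rewrite (inv z) (negbTE zx) eqxx; lia.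
  apply: (IH u' u'' (v' + U_(i))%MM (v'' - U_(i))%MM t Eu).
  - by rewrite Ev {1}Ei addmA.
  - by move: lt_n; rewrite {1}Ei mdegD mdeg1; lia.
  - by right=> w; rewrite edegD Ui inv; lia.
(* Here the last edge came from [v], or the walk is still empty. An edge of [u''] is left at [z] by
   equality of degrees, or by the excess of [u] when [z] is [x]. *)
have /pick[i [t [tz Ei Ui]]] : 0 < edeg u'' z.
  have := inv z; rewrite eqxx; have [zx|zx] := eqVneq z x; last by have := Eduv z zx; lia.
  by move: dx; rewrite Eu Ev !edegD zx; lia.
apply: (IH (u' + U_(i))%MM (u'' - U_(i))%MM v' v'' t _ Ev).
- by rewrite Eu {1}Ei addmA.
- by move: lt_n; rewrite {1}Ei mdegD mdeg1; lia.
- by left=> w; rewrite edegD Ui; have := inv w; lia.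
Qed.

Lemma split_excess u v : offdeg u = offdeg v -> edeg v x < edeg u x ->
  exists p p' q q', [/\ u = (p + p')%MM, v = (q + q')%MM &
    forall w, edeg p w = edeg q w + (w == x).*2].
Proof.
move=> uv dx; apply: (alternating_walk uv dx (u' := 0%MM) (v' := 0%MM) (z := x)).
- by rewrite add0m.
- by rewrite add0m.
- exact: ltnSn.
- by right=> w; rewrite !edeg0.
Qed.

Lemma share_refl u : u != 0%MM -> share u u.
Proof.
move=> u0; suff /existsP[i ui] : [exists i, 0 < u i] by exists i.
apply: contraR u0 => /existsPn H; apply/eqP/mnmP => i.
by rewrite mnm0E; apply/eqP; rewrite -leqn0 leqNgt.
Qed.

Lemma share_sym u v : share u v -> share v u.
Proof. by case=> i [ui vi]; exists i. Qed.

Lemma share_add p q m : 0 < edeg m x -> share (m + p)%MM (m + q)%MM.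
Proof.
by case/edeg_gt0=> i [mi _]; exists i; rewrite !mnmDE; lia.
Qed.

(** Replace [p] by [q] inside [u]. The excess beyond 2 forces [p'] to keep an edge at [x], and this
    edge is shared. *)
Lemma exchange_down u v : offdeg u = offdeg v -> edeg v x + 2 < edeg u x ->
  exists m, [/\ offdeg m = offdeg u, edeg u x = edeg m x + 2 & share u m].
Proof.
move=> uv dx; have [|p [p' [q [q' [uE vE pq]]]]] := split_excess uv; first by lia.
have := pq x; rewrite eqxx => pqx; move: dx; rewrite uE vE !edegD => dx.
exists (q + p')%MM; split.
- by apply/offdegP => w /negbTE wx; rewrite !edegD pq wx addn0.
- by rewrite !edegD pqx; lia.
- by rewrite ![(_ + p')%MM]addmC; apply: share_add; lia.
Qed.

(** Replace [q] by [p] inside [v]. The shared edge lies in [p], whose degree at [x] is at least 2,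
    so any excess suffices. *)
Lemma exchange_up u v : offdeg u = offdeg v -> edeg v x < edeg u x ->
  exists m, [/\ offdeg m = offdeg v, edeg m x = edeg v x + 2 & share u m].
Proof.
move=> uv dx; have [p [p' [q [q' [uE vE pq]]]]] := split_excess uv dx.
have := pq x; rewrite eqxx => pqx.
exists (p + q')%MM; split.
- by apply/offdegP => w /negbTE wx; rewrite vE !edegD pq wx addn0.
- by rewrite vE !edegD pqx; lia.
- by rewrite uE; apply: share_add; lia.
Qed.

End EdgeMonomials.

(** * Passing between the bridge and its contraction *)

(** A chain leaving [Q] contains a link that crosses its boundary. Later [Q] is a condition on the
    bridge exponent or on the degree at [x]. *)
Lemma conn_cross (X : eqType) (eqdeg share : X -> X -> Prop) P (Q : pred X) a b :
  (forall u v, eqdeg u v -> eqdeg v u) -> (forall u v, share u v -> share v u) ->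
  conn eqdeg share P a b -> Q a -> ~~ Q b ->
  exists s t, [/\ conn eqdeg share P a s, Q s, ~~ Q t &
    [\/ eqdeg s t /\ share s t, (s, t) \in P | (t, s) \in P]].
Proof.
move=> eqdegC share_sym ab Qa Qb.
(* This form is symmetric in [a] and [b], as the induction needs for reversed chains. *)
suff: Q a != Q b -> exists s t, [/\ conn eqdeg share P a s, Q s, ~~ Q t &
    [\/ eqdeg s t /\ share s t, (s, t) \in P | (t, s) \in P]].
  by apply; rewrite Qa (negbTE Qb).
elim: ab => {a b Qa Qb}.
- move=> u v uv suv; have cuv := conn_share P uv suv.
  case Qu: (Q u); case Qv: (Q v) => // _.
    exists u, v; split; rewrite ?Qv //; [exact: conn_refl | by apply: Or31].
  exists v, u; split; rewrite ?Qu //; by apply: Or31; split; auto.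
- move=> u v uv; have cuv := conn_mem eqdeg share uv.
  case Qu: (Q u); case Qv: (Q v) => // _.
    exists u, v; split; rewrite ?Qv //; [exact: conn_refl | by apply: Or32].
  exists v, u; split; rewrite ?Qu //; by apply: Or33.
- by move=> u; rewrite eqxx.
- move=> u v uv IH; rewrite eq_sym => /IH[s [t [us Qs Qt st]]].
  exists s, t; split=> //; exact: conn_trans (conn_sym uv) us.
- move=> u v w uv IH1 vw IH2 uw; have [/IH1 //|] := boolP (Q u != Q v).
  rewrite negbK => /eqP uvE; have /IH2[s [t [vs Qs Qt st]]] : Q v != Q w by rewrite -uvE.
  exists s, t; split=> //; exact: conn_trans uv vs.
Qed.

Section Transfer.
Local Open Scope nat_scope.
Variables (T : finType) (E1 E2 : {set {set T}}) (x y : T).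
Hypothesis simple1 : forall f, f \in E1 -> exists a b, a != b /\ f = [set a; b].
Hypothesis simple2 : forall f, f \in E2 -> exists a b, a != b /\ f = [set a; b].

Local Notation M1 := 'X_{1..#|E1|}.
Local Notation M2 := 'X_{1..#|E2|}.
Local Notation off1 := (@offdeg T E1 x).
Local Notation off2 := (@offdeg T E2 y).
Local Notation d1 u := (@edeg T E1 u x).
Local Notation d2 u := (@edeg T E2 u y).

(* A monomial of the graph with the bridge is a triple: its parts on [E1] and
   [E2] and its exponent at the bridge.  A monomial of the contracted graph is
   a pair. *)
Definition eqdegB (a b : M1 * M2 * nat) :=
  [/\ off1 a.1.1 = off1 b.1.1, off2 a.1.2 = off2 b.1.2,
      d1 a.1.1 + a.2 = d1 b.1.1 + b.2 & d2 a.1.2 + a.2 = d2 b.1.2 + b.2].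

Definition shareB (a b : M1 * M2 * nat) :=
  [\/ share a.1.1 b.1.1, share a.1.2 b.1.2 | 0 < a.2 /\ 0 < b.2].

Definition eqdegC (a b : M1 * M2) :=
  [/\ off1 a.1 = off1 b.1, off2 a.2 = off2 b.2 &
      d1 a.1 + d2 a.2 = d1 b.1 + d2 b.2].

Definition shareC (a b : M1 * M2) := share a.1 b.1 \/ share a.2 b.2.

Definition flipBC (q : (M1 * M2 * nat) * (M1 * M2 * nat)) :=
  ((q.1.1.1, q.2.1.2), (q.2.1.1, q.1.1.2)).

(* One of the two truncated differences is zero. *)
Definition flipCB (q : (M1 * M2) * (M1 * M2)) :=
  ((q.1.1, q.2.2, d1 q.2.1 - d1 q.1.1), (q.2.1, q.1.2, d1 q.1.1 - d1 q.2.1)).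

Lemma eqdegB_sym a b : eqdegB a b -> eqdegB b a.
Proof. by case. Qed.

Lemma eqdegC_sym a b : eqdegC a b -> eqdegC b a.
Proof. by case. Qed.

Lemma shareB_sym a b : shareB a b -> shareB b a.
Proof.
by case=> [/share_sym ?|/share_sym ?|[? ?]]; [apply: Or31 | apply: Or32 | apply: Or33].
Qed.

Lemma shareC_sym a b : shareC a b -> shareC b a.
Proof. by case=> /share_sym ?; [left | right]. Qed.

Lemma conn_eqdB P a b :
  (forall q, q \in P -> eqdegB q.1 q.2) -> conn eqdegB shareB P a b -> eqdegB a b.
Proof.
apply: conn_eqd => [//|? ? /eqdegB_sym //|c d e [? ? ? ?] [? ? ? ?]].
by split; congruence.
Qed.

Lemma conn_eqdC P a b :
  (forall q, q \in P -> eqdegC q.1 q.2) -> conn eqdegC shareC P a b -> eqdegC a b.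
Proof.
apply: conn_eqd => [//|? ? /eqdegC_sym //|c d e [? ? ?] [? ? ?]].
by split; congruence.
Qed.

Lemma off1_eq0 u v : u = 0%MM -> off1 u = off1 v -> v = 0%MM.
Proof. by move=> -> /esym /(offdeg_eq0 simple1). Qed.

Lemma off2_eq0 u v : u = 0%MM -> off2 u = off2 v -> v = 0%MM.
Proof. by move=> -> /esym /(offdeg_eq0 simple2). Qed.

Lemma odd1 (u v : M1) : off1 u = off1 v -> odd (d1 u) = odd (d1 v).
Proof. exact: odd_offdeg. Qed.

(** * From linking families with the bridge to the contraction *)

Section BtoC.
Variable P : seq ((M1 * M2 * nat) * (M1 * M2 * nat)).
Hypothesis P_eqd : forall q, q \in P -> eqdegB q.1 q.2.
Hypothesis P_span : forall u v, eqdegB u v -> conn eqdegB shareB P u v.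

Local Notation Q := (map flipBC P).
Local Notation connB := (conn eqdegB shareB P).
Local Notation connC := (conn eqdegC shareC Q).

Lemma flipBC_eqd q : q \in Q -> eqdegC q.1 q.2.
Proof.
case/mapP=> [[[[p1 p2] k] [[q1 q2] l]] /P_eqd[/= ? ? ? ?] ->].
by split=> //=; lia.
Qed.

(** When the [E2] part is trivial, it stays trivial along the chain and so does the bridge exponent;
    the flip then acts as the identity on the links met. *)
Lemma flatC1 u a b : connB a b -> eqdegB (u, 0%MM, 0) a -> connC a.1 b.1.
Proof.
have pure c : eqdegB (u, 0%MM, 0) c -> c.1.2 = 0%MM /\ c.2 = 0.
  case=> /= _ H _ d; have c0 : c.1.2 = 0%MM by apply: off2_eq0 H.
  by split=> //; move: d; rewrite c0 edeg0; lia.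
move=> ab ua; have [a0 ka] := pure _ ua.
have tr c d : connB c d -> eqdegB (u, 0%MM, 0) c -> eqdegB (u, 0%MM, 0) d.
  by move=> /(conn_eqdB P_eqd)[? ? ? ?] [? ? ? ?]; split; by [congruence|lia].
elim: ab ua {a0 ka} => {a b}.
- move=> a b [ab1 ab2 d1ab d2ab] sab ua.
  have ub : eqdegB (u, 0%MM, 0) b by apply: tr ua; apply: conn_share.
  have [a0 ka] := pure _ ua; have [b0 kb] := pure _ ub.
  apply: conn_share.
    by split=> //; rewrite a0 b0; move: d1ab; rewrite ka kb !addn0 => ->.
  case: sab => [|[i]|]; rewrite ?a0 ?ka ?mnm0E; [by left|by case|by case].
- move=> a b ab ua.
  have ub : eqdegB (u, 0%MM, 0) b by apply: tr ua; apply: conn_mem.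
  have [a0 ka] := pure _ ua; have [b0 kb] := pure _ ub.
  apply: conn_mem; apply/mapP; exists (a, b) => //; rewrite /flipBC /=.
  by case: a b a0 b0 {ab ua ub ka kb} => [[a1 a2] k] [[b1 b2] l] /= -> ->.
- by move=> a _; apply: conn_refl.
- by move=> a b ab IH ub; apply/conn_sym/IH; apply: tr (conn_sym ab) ub.
- move=> a b c ab IH1 bc IH2 ua; apply: conn_trans (IH1 ua) _.
  by apply: IH2; apply: tr ab ua.
Qed.

(** As in [flatC1], except that the flip reverses the pairs met. *)
Lemma flatC2 u a b : connB a b -> eqdegB (0%MM, u, 0) a -> connC a.1 b.1.
Proof.
have pure c : eqdegB (0%MM, u, 0) c -> c.1.1 = 0%MM /\ c.2 = 0.
  case=> /= H _ d _; have c0 : c.1.1 = 0%MM by apply: off1_eq0 H.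
  by split=> //; move: d; rewrite c0 edeg0; lia.
move=> ab ua; have [a0 ka] := pure _ ua.
have tr c d : connB c d -> eqdegB (0%MM, u, 0) c -> eqdegB (0%MM, u, 0) d.
  by move=> /(conn_eqdB P_eqd)[? ? ? ?] [? ? ? ?]; split; by [congruence|lia].
elim: ab ua {a0 ka} => {a b}.
- move=> a b [ab1 ab2 d1ab d2ab] sab ua.
  have ub : eqdegB (0%MM, u, 0) b by apply: tr ua; apply: conn_share.
  have [a0 ka] := pure _ ua; have [b0 kb] := pure _ ub.
  apply: conn_share.
    by split=> //; rewrite a0 b0; move: d2ab; rewrite ka kb !addn0 => ->.
  case: sab => [[i]||]; rewrite ?a0 ?ka ?mnm0E; [by case|by right|by case].
- move=> a b ab ua.
  have ub : eqdegB (0%MM, u, 0) b by apply: tr ua; apply: conn_mem.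
  have [a0 ka] := pure _ ua; have [b0 kb] := pure _ ub.
  apply: conn_sym; apply: conn_mem; apply/mapP; exists (a, b) => //; rewrite /flipBC /=.
  by case: a b a0 b0 {ab ua ub ka kb} => [[a1 a2] k] [[b1 b2] l] /= -> ->.
- by move=> a _; apply: conn_refl.
- by move=> a b ab IH ub; apply/conn_sym/IH; apply: tr (conn_sym ab) ub.
- move=> a b c ab IH1 bc IH2 ua; apply: conn_trans (IH1 ua) _.
  by apply: IH2; apply: tr ab ua.
Qed.

(** If neither part is trivial, change one part at a time while sharing the other; otherwise
    everything happens on one side. *)
Lemma flatC u1 u2 v1 v2 : off1 u1 = off1 v1 -> off2 u2 = off2 v2 ->
  d1 u1 = d1 v1 -> d2 u2 = d2 v2 -> connC (u1, u2) (v1, v2).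
Proof.
move=> o1 o2 e1 e2.
have [u20|u20] := eqVneq u2 0%MM.
  have v20 := off2_eq0 u20 o2.
  have := @flatC1 u1 (u1, u2, 0) (v1, v2, 0); rewrite u20 v20; apply=> //.
  by apply: P_span; split=> //=; lia.
have [u10|u10] := eqVneq u1 0%MM.
  have v10 := off1_eq0 u10 o1.
  have := @flatC2 u2 (u1, u2, 0) (v1, v2, 0); rewrite u10 v10; apply=> //.
  by apply: P_span; split=> //=; lia.
have v10 : v1 != 0%MM by apply: contra u10 => /eqP v0; apply/eqP/(off1_eq0 v0).
apply: (conn_trans (v1, u2)); apply: conn_share.
- by split=> //=; lia.
- by right; apply: share_refl.
- by split=> //=; lia.
- by left; apply: share_refl.
Qed.

Lemma connC_le u1 u2 v1 v2 : eqdegC (u1, u2) (v1, v2) -> d1 v1 <= d1 u1 ->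
  connC (u1, u2) (v1, v2).
Proof.
move=> [/= o1 o2 e]; rewrite leq_eqVlt => /predU1P[d|d].
  by apply: flatC => //; lia.
have par := odd1 o1.
have [d3|d2] := ltnP (d1 v1 + 2) (d1 u1).
  (* The middle monomial shares an edge of [E1] with the first pair and an edge of [E2] with the
     second. *)
  have [w1 [ow1 dw1 sw1]] := exchange_down simple1 o1 d3.
  have [|w2 [ow2 dw2 sw2]] := exchange_up simple2 (esym o2); first by lia.
  apply: (conn_trans (w1, w2)); apply: conn_share.
  - by split=> /=; [congruence|congruence|lia].
  - by left.
  - by split=> /=; [congruence|congruence|lia].
  - by right; apply: share_sym.
have {d d2 par} d : d1 u1 = d1 v1 + 2 by lia.
(* With a difference of exactly 2, exchanging the [E2] parts gives triples of equal degree with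
   bridge exponents 0 and 2. A chain between them has a link where the exponent becomes positive. *)
have /P_span c : eqdegB (u1, v2, 0) (v1, u2, 2) by split=> /=; [| |lia|lia].
have [[[p1 p2] k] [[[q1 q2] l] [cs /= /eqP k0 l0 st]]] :=
  @conn_cross _ eqdegB shareB P (fun a => a.2 == 0) _ _ eqdegB_sym shareB_sym c erefl erefl.
move: k0 cs st => -> cs st; rewrite -lt0n in l0.
have [/= os1 os2 ds1 ds2] := conn_eqdB P_eqd cs.
have [/= ot1 ot2 dt1 dt2] : eqdegB (p1, p2, 0) (q1, q2, l).
  by case: st => [[]|/P_eqd|/P_eqd/eqdegB_sym].
have par := odd1 ot1.
(* If the exponent jumps by more than 2, the degree of [p1] at [x] drops enough for a direct
   exchange within [E1]. *)
have [l3|l2] := ltnP 2 l.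
  have [|w [ow dw sw]] := exchange_down simple1 ot1; first by lia.
  apply: (conn_trans (p1, u2)); first by apply: flatC => //; lia.
  apply: (conn_trans (w, v2)); last by apply: flatC; by [congruence|lia].
  apply: conn_share; last by left.
  by split=> /=; by [congruence|lia].
have {l2 l0 par} l2 : l = 2 by lia.
case: st => [[_]|st|st].
(* The bridge itself cannot be shared, being absent on one side; a shared edge of [E1] or [E2]
   remains shared after the [E2] parts are exchanged. *)
- case=> /= [s|s|[]] //.
    apply: (conn_trans (p1, u2)); first by apply: flatC => //; lia.
    apply: (conn_trans (q1, v2)); last by apply: flatC; by [congruence|lia].
    apply: conn_share; last by left.
    by split=> /=; by [congruence|lia].
  apply: (conn_trans (u1, q2)); first by apply: flatC => //; by [congruence|lia].
  apply: (conn_trans (v1, p2)); last by apply: flatC; by [congruence|lia].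
  apply: conn_share; last by right; apply: share_sym.
  by split=> /=; by [congruence|lia].
- apply: (conn_trans (p1, q2)); first by apply: flatC => //; by [congruence|lia].
  apply: (conn_trans (q1, p2)); last by apply: flatC; by [congruence|lia].
  by apply: conn_mem; apply/mapP; exists ((p1, p2, 0), (q1, q2, l)).
- apply: (conn_trans (p1, q2)); first by apply: flatC => //; by [congruence|lia].
  apply: (conn_trans (q1, p2)); last by apply: flatC; by [congruence|lia].
  by apply/conn_sym/conn_mem; apply/mapP; exists ((q1, q2, l), (p1, p2, 0)).
Qed.

Lemma connC_span u v : eqdegC u v -> connC u v.
Proof.
case: u v => [u1 u2] [v1 v2] uv.
have [le|/ltnW le] := leqP (d1 v1) (d1 u1); first exact: connC_le.
by apply/conn_sym/connC_le => //; apply: eqdegC_sym.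
Qed.

End BtoC.

(** * From linking families of the contraction back to the bridge *)

Section CtoB.
Variable Q : seq ((M1 * M2) * (M1 * M2)).
Hypothesis Q_eqd : forall q, q \in Q -> eqdegC q.1 q.2.
Hypothesis Q_span : forall u v, eqdegC u v -> conn eqdegC shareC Q u v.

Local Notation P := (map flipCB Q).
Local Notation connB := (conn eqdegB shareB P).
Local Notation connC := (conn eqdegC shareC Q).

Lemma flipCB_eqd q : q \in P -> eqdegB q.1 q.2.
Proof.
case/mapP=> [[[p1 p2] [q1 q2]] /Q_eqd[/= ? ? ?] ->].
by split=> //=; lia.
Qed.

(** With a trivial [E2] part the degrees at [x] agree along the chain, so [flipCB] restores bridge
    exponent 0 on both members. *)
Lemma flatB1 u a b : connC a b -> eqdegC (u, 0%MM) a -> connB (a, 0) (b, 0).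
Proof.
have pure c : eqdegC (u, 0%MM) c -> c.2 = 0%MM.
  by case: c => [c1 c2] [/= _ H _]; apply: off2_eq0 H.
move=> ab ua.
have tr c d : connC c d -> eqdegC (u, 0%MM) c -> eqdegC (u, 0%MM) d.
  by move=> /(conn_eqdC Q_eqd)[? ? ?] [? ? ?]; split; congruence.
elim: ab ua => {a b}.
- move=> a b [ab1 ab2 dab] sab ua.
  have ub : eqdegC (u, 0%MM) b by apply: tr ua; apply: conn_share.
  have a0 := pure _ ua; have b0 := pure _ ub.
  move: dab; rewrite a0 b0 edeg0 !addn0 => dab.
  apply: conn_share; first by split=> //=; rewrite ?a0 ?b0 ?dab.
  case: sab => [|[i]]; rewrite ?a0 ?mnm0E; [by move=> s; apply: Or31|by case].
- move=> a b ab ua.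
  have ub : eqdegC (u, 0%MM) b by apply: tr ua; apply: conn_mem.
  have a0 := pure _ ua; have b0 := pure _ ub.
  apply: conn_mem; apply/mapP; exists (a, b) => //; rewrite /flipCB /=.
  have [_ _ /=] := Q_eqd ab; rewrite a0 b0 edeg0 !addn0 => ->; rewrite subnn.
  by case: a b a0 b0 {ab ua ub} => [a1 a2] [b1 b2] /= -> ->.
- by move=> a _; apply: conn_refl.
- by move=> a b ab IH ub; apply/conn_sym/IH; apply: tr (conn_sym ab) ub.
- move=> a b c ab IH1 bc IH2 ua; apply: conn_trans (IH1 ua) _.
  by apply: IH2; apply: tr ab ua.
Qed.

Lemma flatB2 u a b : connC a b -> eqdegC (0%MM, u) a -> connB (a, 0) (b, 0).
Proof.
have pure c : eqdegC (0%MM, u) c -> c.1 = 0%MM.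
  by case: c => [c1 c2] [/= H _ _]; apply: off1_eq0 H.
move=> ab ua.
have tr c d : connC c d -> eqdegC (0%MM, u) c -> eqdegC (0%MM, u) d.
  by move=> /(conn_eqdC Q_eqd)[? ? ?] [? ? ?]; split; congruence.
elim: ab ua => {a b}.
- move=> a b [ab1 ab2 dab] sab ua.
  have ub : eqdegC (0%MM, u) b by apply: tr ua; apply: conn_share.
  have a0 := pure _ ua; have b0 := pure _ ub.
  move: dab; rewrite a0 b0 edeg0 !add0n => dab.
  apply: conn_share; first by split=> //=; rewrite ?a0 ?b0 ?dab.
  case: sab => [[i]|]; rewrite ?a0 ?mnm0E; [by case|by move=> s; apply: Or32].
- move=> a b ab ua.
  have ub : eqdegC (0%MM, u) b by apply: tr ua; apply: conn_mem.
  have a0 := pure _ ua; have b0 := pure _ ub.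
  apply/conn_sym/conn_mem; apply/mapP; exists (a, b) => //; rewrite /flipCB /=.
  rewrite a0 b0 subnn.
  by case: a b a0 b0 {ab ua ub} => [a1 a2] [b1 b2] /= -> ->.
- by move=> a _; apply: conn_refl.
- by move=> a b ab IH ub; apply/conn_sym/IH; apply: tr (conn_sym ab) ub.
- move=> a b c ab IH1 bc IH2 ua; apply: conn_trans (IH1 ua) _.
  by apply: IH2; apply: tr ab ua.
Qed.

Lemma flatB u1 u2 v1 v2 : off1 u1 = off1 v1 -> off2 u2 = off2 v2 ->
  d1 u1 = d1 v1 -> d2 u2 = d2 v2 -> connB (u1, u2, 0) (v1, v2, 0).
Proof.
move=> o1 o2 e1 e2.
have [u20|u20] := eqVneq u2 0%MM.
  have v20 := off2_eq0 u20 o2.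
  apply: (@flatB1 u1); last by rewrite u20.
  by apply: Q_span; split=> //=; lia.
have [u10|u10] := eqVneq u1 0%MM.
  have v10 := off1_eq0 u10 o1.
  apply: (@flatB2 u2); last by rewrite u10.
  by apply: Q_span; split=> //=; lia.
have v10 : v1 != 0%MM by apply: contra u10 => /eqP v0; apply/eqP/(off1_eq0 v0).
apply: (conn_trans (v1, u2, 0)); apply: conn_share.
- by split=> //=; lia.
- by apply: Or32; apply: share_refl.
- by split=> //=; lia.
- by apply: Or31; apply: share_refl.
Qed.

Lemma bridgeB a b : eqdegB a b -> 0 < a.2 -> 0 < b.2 -> connB a b.
Proof. by move=> ab a0 b0; apply: conn_share => //; apply: Or33. Qed.

Lemma connB_le p1 p2 k q1 q2 l : eqdegB (p1, p2, k) (q1, q2, l) -> k <= l ->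
  connB (p1, p2, k) (q1, q2, l).
Proof.
move=> pq; have [k0|k0] := posnP k; last by move=> kl; apply: bridgeB => //=; lia.
move: k0 pq => -> [/= o1 o2 e1 e2] _.
have [l0|l0] := posnP l; first by rewrite l0; apply: flatB => //; lia.
have par := odd1 o1.
(* Both parts can be lowered by 2 at their end of the bridge; the result shares an edge with the
   first triple and the bridge with the second. *)
have [l3|l2] := ltnP 2 l.
  have [|w1 [ow1 dw1 sw1]] := exchange_down simple1 o1; first by lia.
  have [|w2 [ow2 dw2 _]] := exchange_down simple2 o2; first by lia.
  apply: (conn_trans (w1, w2, 2)).
    by apply: conn_share; [split=> //=; lia | apply: Or31].
  by apply: bridgeB => //; split=> /=; by [congruence|lia].
have {l2 l0 par} l2 : l = 2 by lia.
(* Exchanging the [E2] parts gives pairs of equal degree; on a chain between them, look at a link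
   where the degree at [x] falls below that of [p1]. *)
have /Q_span c : eqdegC (p1, q2) (q1, p2) by split=> //=; lia.
have q1p1 : ~~ (d1 p1 <= d1 q1) by lia.
have [[w1 w2] [[z1 z2] [cs /= k0 l0 st]]] :=
  @conn_cross _ eqdegC shareC Q (fun a => d1 p1 <= d1 a.1) _ _
    eqdegC_sym shareC_sym c (leqnn _) q1p1.
rewrite -ltnNge in l0.
have [/= os1 os2 ds] := conn_eqdC Q_eqd cs.
have [/= ot1 ot2 dt] : eqdegC (w1, w2) (z1, z2).
  by case: st => [[]|/Q_eqd|/Q_eqd/eqdegC_sym].
have par := odd1 os1; have par' := odd1 ot1.
have last_step : forall m1 m2, off1 m1 = off1 q1 -> off2 m2 = off2 q2 ->
    d1 m1 = d1 q1 -> d2 m2 = d2 q2 -> connB (m1, m2, 2) (q1, q2, l).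
  by move=> m1 m2 *; apply: bridgeB; rewrite ?l2 //; split=> //=; lia.
(* If the link starts too high at [x], then [w2] is low enough at [y] to exchange against [p2]; if
   it ends too low, [z1] serves to exchange against [p1]. What is left is a drop by exactly 2 from
   the degree of [p1]. *)
have [w3|w2'] := ltnP (d1 p1) (d1 w1).
  have [||w [ow dw sw]] := @exchange_down _ _ y simple2 p2 w2; [by congruence|by lia|].
  apply: (conn_trans (q1, w, 2)); last by apply: last_step; by [congruence|lia].
  by apply: conn_share; [split=> /=; by [congruence|lia] | apply: Or32].
have [z3|z2'] := ltnP (d1 z1 + 2) (d1 p1).
  have [||w [ow dw sw]] := @exchange_down _ _ x simple1 p1 z1; [by congruence|by lia|].
  apply: (conn_trans (w, q2, 2)); last by apply: last_step; by [congruence|lia].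
  by apply: conn_share; [split=> /=; by [congruence|lia] | apply: Or31].
have {w2' k0} dw : d1 w1 = d1 p1 by lia.
have {z2' l0 par par'} dz : d1 w1 = d1 z1 + 2 by lia.
case: st => [[_]|st|st].
- case=> /= s.
    apply: (conn_trans (w1, p2, 0)); first by apply: flatB => //; lia.
    apply: (conn_trans (z1, q2, 2)); last by apply: last_step; by [congruence|lia].
    by apply: conn_share; [split=> /=; by [congruence|lia] | apply: Or31].
  apply: (conn_trans (p1, z2, 0)); first by apply: flatB; by [congruence|lia].
  apply: (conn_trans (q1, w2, 2)); last by apply: last_step; by [congruence|lia].
  by apply: conn_share; [split=> /=; by [congruence|lia] | apply: Or32; apply: share_sym].
- apply: (conn_trans (w1, z2, 0)); first by apply: flatB; by [congruence|lia].
  apply: (conn_trans (z1, w2, 2)); last by apply: last_step; by [congruence|lia].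
  apply: conn_mem; apply/mapP; exists ((w1, w2), (z1, z2)) => //.
  by rewrite /flipCB /=; congr (_, _, _, (_, _, _)); lia.
- apply: (conn_trans (w1, z2, 0)); first by apply: flatB; by [congruence|lia].
  apply: (conn_trans (z1, w2, 2)); last by apply: last_step; by [congruence|lia].
  apply/conn_sym/conn_mem; apply/mapP; exists ((z1, z2), (w1, w2)) => //.
  by rewrite /flipCB /=; congr (_, _, _, (_, _, _)); lia.
Qed.

Lemma connB_span u v : eqdegB u v -> connB u v.
Proof.
case: u v => [[u1 u2] k] [[v1 v2] l] uv.
have [le|/ltnW le] := leqP k l; first exact: connB_le.
by apply/conn_sym/connB_le => //; apply: eqdegB_sym.
Qed.

End CtoB.

Lemma span_by_contract m : span_by eqdegB shareB m <-> span_by eqdegC shareC m.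
Proof.
split=> [[P [<- eP sP]] | [Q [<- eQ sQ]]].
  exists (map flipBC P); split; first by rewrite size_map.
    by move=> q; apply: flipBC_eqd.
  by move=> u v; apply: connC_span.
exists (map flipCB Q); split; first by rewrite size_map.
  by move=> q; apply: flipCB_eqd.
by move=> u v; apply: connB_span.
Qed.

End Transfer.

(** * Change of model for monomials and reindexing of edges *)

Lemma span_by_transport (X Y : eqType) (eqX shX : X -> X -> Prop)
    (eqY shY : Y -> Y -> Prop) (f : X -> Y) (g : Y -> X) m :
  cancel g f ->
  (forall u v, eqX u v <-> eqY (f u) (f v)) ->
  (forall u v, shX u v -> shY (f u) (f v)) ->
  span_by eqX shX m -> span_by eqY shY m.
Proof.
move=> gK eqXY shXY [P [<- eP sP]].
exists [seq (f q.1, f q.2) | q <- P]; split; first by rewrite size_map.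
  by move=> _ /mapP[q /eP/eqXY qq ->].
move=> u v uv; rewrite -(gK u) -(gK v).
have /sP : eqX (g u) (g v) by apply/eqXY; rewrite !gK.
elim=> {u v uv} [u v /eqXY ? /shXY ?|u v uv|u|u v _|u v w _ ? _ ?]; eauto using conn.
by apply: conn_mem; apply/mapP; exists (u, v).
Qed.

(** Frees the variables from the enumeration order of the edge set: any repetition-free
    parametrisation of the edges may index them. *)
Lemma edge_indexing (T J : finType) (E : {set {set T}}) (F : J -> {set T}) :
  injective F -> E = [set F j | j : J] ->
  exists s : J -> 'I_#|E|, bijective s /\ forall j, enum_val (s j) = F j.
Proof.
move=> injF EE.
have /fin_all_exists[s sE] j : exists i : 'I_#|E|, enum_val i = F j.
  have Fj : F j \in E by rewrite EE imset_f.
  by exists (enum_rank_in Fj (F j)); rewrite enum_rankK_in.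
exists s; split=> //; apply: inj_card_bij.
  by move=> i j ij; apply: injF; rewrite -!sE ij.
by rewrite card_ord EE card_imset.
Qed.

(** * Toric ideals as kernels of monomial maps *)

Section ToricExponents.
Variables (K : fieldType) (T : finType) (E : {set {set T}}).

Definition edge_exp (i : 'I_#|E|) : 'X_{1..#|T|} :=
  (\sum_(v in enum_val i) U_(enum_rank v))%MM.

Lemma toric_idealE : @toric_ideal K T E = mker edge_exp.
Proof.
apply: functional_extensionality => p; rewrite /toric_ideal /toric_map /mker.
congr (comp_mpoly _ _ == _); apply: eq_mktuple => i.
rewrite /edge_monomial /edge_exp.
by rewrite (big_morph _ (@mpolyXD _ K) (mpolyX0 _ K)).
Qed.

Lemma mexp_edge u z : mexp edge_exp u (enum_rank z) = edeg u z.
Proof.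
rewrite /mexp mnm_sumE; apply: eq_bigr => i _; rewrite mulmnE mulnC; congr (_ * _)%N.
rewrite mnm_sumE; under eq_bigr => v _ do rewrite mnm1E (inj_eq enum_rank_inj).
have [zi|zi] := boolP (z \in enum_val i).
  by rewrite (bigD1 z) //= eqxx big1 // => v /andP[_ /negbTE ->].
by rewrite big1 // => v vi; case: eqP vi => // ->; rewrite (negbTE zi).
Qed.

Lemma eqdeg_edge u v : eqdeg edge_exp u v <-> forall z, edeg u z = edeg v z.
Proof.
split=> [uv z|uv]; first by rewrite -!mexp_edge uv.
by apply/mnmP => i; rewrite -(enum_valK i) !mexp_edge.
Qed.

Lemma edge_exp_neq0 i : (enum_val i != set0) -> edge_exp i != 0%MM.
Proof.
case/set0Pn=> z zi; apply/eqP => /mnmP /(_ (enum_rank z)); rewrite mnm0E mnm_sumE.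
by rewrite (bigD1 z) //= mnm1E eqxx.
Qed.

End ToricExponents.

Lemma eq_beta1 (K : fieldType) (T T' : finType) (E : {set {set T}}) (E' : {set {set T'}}) :
  set0 \notin E -> set0 \notin E' ->
  (forall m, span_by (eqdeg (@edge_exp T E)) (@share #|E|) m <->
             span_by (eqdeg (@edge_exp T' E')) (@share #|E'|) m) ->
  beta1 K E = beta1 K E'.
Proof.
have nz (S : finType) (F : {set {set S}}) : set0 \notin F -> forall i, @edge_exp S F i != 0%MM.
  move=> F0 i; apply: (@edge_exp_neq0 S F); apply: contra F0 => /eqP <-; exact: enum_valP.
move=> /nz E0 /nz E0' EE'; rewrite /beta1 !toric_idealE; apply: eq_mu => m.
have H := generates_spanP K E0 m; have H' := generates_spanP K E0' m.
by split=> [/H/EE'/H' | /H'/EE'/H].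
Qed.

(** * The graph with the bridge and its contraction in coordinates *)

Section Bridge.
Local Open Scope nat_scope.
Variables (T : finType) (V1 V2 : {set T}) (E1 E2 : {set {set T}}) (x y : T).
Hypotheses (g1 : simple_graph V1 E1) (g2 : simple_graph V2 E2).
Hypotheses (dV : [disjoint V1 & V2]) (xV : x \in V1) (yV : y \in V2).
Let e := [set x; y].
Let E := E1 :|: E2 :|: [set e].

Lemma x_notin_V2 : x \notin V2.
Proof. by rewrite (disjointFr dV xV). Qed.
Lemma y_notin_V1 : y \notin V1.
Proof. by rewrite (disjointFl dV yV). Qed.

Lemma simple_graph_edge V (F : {set {set T}}) : simple_graph V F ->
  forall f, f \in F -> exists a b, a != b /\ f = [set a; b].
Proof. by move=> gF f /gF [a [b [ab _ _ ->]]]; exists a, b. Qed.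

Lemma edge_subset V (F : {set {set T}}) f : simple_graph V F -> f \in F -> f \subset V.
Proof.
move=> gF /gF [a [b [_ aV bV ->]]].
by apply/subsetP => z; rewrite !inE => /orP[] /eqP ->.
Qed.

Lemma edge_other V (F : {set {set T}}) f z : simple_graph V F -> f \in F ->
  exists2 t, t \in f & t != z.
Proof.
move=> gF /gF [a [b [ab aV bV ->]]]; have [az|az] := eqVneq a z.
  by exists b; rewrite ?inE ?eqxx ?orbT // -az eq_sym.
by exists a; rewrite ?inE ?eqxx.
Qed.

Lemma edeg_out V (F : {set {set T}}) (u : 'X_{1..#|F|}) z :
  simple_graph V F -> z \notin V -> edeg u z = 0.
Proof.
move=> gF zV; apply: big1 => i _.
have /subsetP/(_ z) := edge_subset gF (enum_valP i).
by case: (z \in _) => [/(_ isT)|]; rewrite ?(negbTE zV) // muln0.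
Qed.

(** Edges of the two sides differ because their vertex sets are disjoint, and the bridge has an end
    outside each side. *)
Lemma bridge_indexing : exists s : 'I_#|E1| + 'I_#|E2| + unit -> 'I_#|E|,
  bijective s /\ forall j, enum_val (s j) = match j with
    | inl (inl i) => enum_val i | inl (inr i) => enum_val i | inr _ => e end.
Proof.
have n12 f : f \in E1 -> f \in E2 -> False.
  move=> f1 f2; have [t tf _] := edge_other x g1 f1.
  have := subsetP (edge_subset g1 f1) _ tf; have := subsetP (edge_subset g2 f2) _ tf.
  by move=> t2 t1; rewrite (disjointFr dV t1) in t2.
have n1 : e \notin E1.
  by apply: contra y_notin_V1 => /(edge_subset g1)/subsetP; apply; rewrite !inE eqxx orbT.
have n2 : e \notin E2.
  by apply: contra x_notin_V2 => /(edge_subset g2)/subsetP; apply; rewrite !inE eqxx.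
apply: edge_indexing.
  move=> [[i|i]|[]] [[j|j]|[]] // => [/enum_val_inj -> //|H|H|H|/enum_val_inj -> //|H|H|H].
  - by case: (n12 (enum_val i)); rewrite ?enum_valP // H enum_valP.
  - by case/negP: n1; rewrite -H enum_valP.
  - by case: (n12 (enum_val i)); rewrite ?enum_valP // H enum_valP.
  - by case/negP: n2; rewrite -H enum_valP.
  - by case/negP: n1; rewrite H enum_valP.
  - by case/negP: n2; rewrite H enum_valP.
apply/setP => f; rewrite !inE; apply/orP/imsetP => [[/orP[fE|fE]|/eqP ->]|[[[i|i]|[]] _ ->]].
- by exists (inl (inl (enum_rank_in fE f))); rewrite ?enum_rankK_in.
- by exists (inl (inr (enum_rank_in fE f))); rewrite ?enum_rankK_in.
- by exists (inr tt).
- by left; rewrite enum_valP.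
- by left; rewrite enum_valP orbT.
- by right.
Qed.

Lemma chi_out z : z \notin e -> chi e z = Some z.
Proof. by rewrite /chi => /negbTE ->. Qed.

Lemma some_chi (f : {set T}) z : (Some z \in chi e @: f) = (z \in f) && (z \notin e).
Proof.
apply/imsetP/andP => [[t tf]|[zf ze]]; last by exists z; rewrite ?chi_out.
by rewrite /chi; case: ifPn => // te [->].
Qed.

Lemma none_chi (f : {set T}) : (None \in chi e @: f) = (x \in f) || (y \in f).
Proof.
apply/imsetP/orP => [[t tf]|[] zf].
- rewrite /chi; case: ifPn => //; rewrite !inE => /orP[] /eqP <- _; by [left|right].
- by exists x; rewrite // /chi !inE eqxx.
- by exists y; rewrite // /chi !inE eqxx orbT.
Qed.

Lemma edges_but_bridge : E :\ e = E1 :|: E2.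
Proof.
apply/setP => f; rewrite !inE; have [->|fe] //= := eqVneq f e.
  apply/esym/negbTE; rewrite negb_or; apply/andP; split.
    by apply: contra y_notin_V1 => /(edge_subset g1)/subsetP; apply; rewrite !inE eqxx orbT.
  by apply: contra x_notin_V2 => /(edge_subset g2)/subsetP; apply; rewrite !inE eqxx.
by rewrite orbF.
Qed.

(** Contraction merges no two edges. An edge of [E1] has an end other than [x], which survives and
    lies outside [V2]; within one side only one of [x] and [y] can occur, so the new vertex
    determines the old end. *)
Lemma contr_indexing : exists s : 'I_#|E1| + 'I_#|E2| -> 'I_#|contr_E E e|,
  bijective s /\ forall j, enum_val (s j) = match j with
    | inl i => chi e @: enum_val i | inr i => chi e @: enum_val i end.
Proof.
have n12 f h : f \in E1 -> h \in E2 -> chi e @: f <> chi e @: h.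
  move=> f1 h2 /setP eq_fh; have [t tf tx] := edge_other x g1 f1.
  have t1 := subsetP (edge_subset g1 f1) _ tf.
  have te : t \notin e.
    by rewrite !inE (negbTE tx); apply: contraNneq y_notin_V1 => <-.
  have := eq_fh (Some t); rewrite !some_chi tf te /= andbT => /esym th.
  by have := subsetP (edge_subset g2 h2) _ th; rewrite (disjointFr dV t1).
have inj_chi V F : simple_graph V F -> (x \notin V) || (y \notin V) ->
    {in F &, injective (fun f : {set T} => chi e @: f)}.
  move=> gF xyV f h fF hF /setP eq_fh; apply/setP => z.
  have := eq_fh (Some z); rewrite !some_chi; case: (boolP (z \in e)); last by rewrite !andbT.
  have out t r : r \in F -> t \notin V -> (t \in r) = false.
    move=> rF tV; apply/negP => tr; case/negP: tV.
    exact: (subsetP (edge_subset gF rF)).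
  have := eq_fh None; rewrite !none_chi.
  case/orP: xyV => nV; rewrite !(out _ _ _ nV) // ?orbF /= => eqz;
    by rewrite !inE => /orP[] /eqP -> _; rewrite ?(out _ _ _ nV).
apply: edge_indexing.
  move=> [i|i] [j|j] /=.
  - move=> H; congr inl; apply: enum_val_inj.
    by apply: (inj_chi V1 E1 g1); rewrite ?enum_valP ?y_notin_V1 ?orbT.
  - by move/n12 => []; rewrite enum_valP.
  - by move/esym/n12 => []; rewrite enum_valP.
  - move=> H; congr inr; apply: enum_val_inj.
    by apply: (inj_chi V2 E2 g2); rewrite ?enum_valP ?x_notin_V2.
rewrite /contr_E edges_but_bridge; apply/setP => f; apply/imsetP/imsetP.
  case=> h; rewrite inE => /orP[hE|hE] ->.
    by exists (inl (enum_rank_in hE h)); rewrite ?enum_rankK_in.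
  by exists (inr (enum_rank_in hE h)); rewrite ?enum_rankK_in.
by case=> [[i|i] _ ->]; exists (enum_val i); rewrite // inE enum_valP ?orbT.
Qed.

Let simple1 := simple_graph_edge g1.
Let simple2 := simple_graph_edge g2.

Lemma span_by_bridge m : span_by (eqdeg (@edge_exp T E)) (@share #|E|) m <->
  span_by (@eqdegB T E1 E2 x y) (@shareB T E1 E2) m.
Proof.
have [s [[s' sK s'K] sE]] := bridge_indexing.
pose f (u : 'X_{1..#|E|}) : 'X_{1..#|E1|} * 'X_{1..#|E2|} * nat :=
  ([multinom u (s (inl (inl i))) | i < #|E1|],
   [multinom u (s (inl (inr i))) | i < #|E2|], u (s (inr tt))).
pose g (a : 'X_{1..#|E1|} * 'X_{1..#|E2|} * nat) : 'X_{1..#|E|} :=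
  [multinom match s' j with
    | inl (inl i) => a.1.1 i | inl (inr i) => a.1.2 i | inr _ => a.2 end | j < #|E|].
have fK : cancel f g.
  move=> u; apply/mnmP => j; rewrite mnmE -[j in RHS]s'K.
  by case: (s' j) => [[i|i]|[]] /=; rewrite ?mnmE.
have gK : cancel g f.
  case=> [[a b] k]; rewrite /f /g; congr (_, _, _); last by rewrite mnmE sK.
    by apply/mnmP => i; rewrite !mnmE sK.
  by apply/mnmP => i; rewrite !mnmE sK.
have degE u z : edeg u z = edeg (f u).1.1 z + edeg (f u).1.2 z + (f u).2 * (z \in e).
  rewrite /edeg (reindex s) /=; last by exists s' => ? _.
  rewrite !big_sumType /= (big_pred1 tt) => [|[]//]; rewrite sE.
  by congr (_ + _ + _); apply: eq_bigr => i _; rewrite sE mnmE.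
have eqP u v : eqdeg (@edge_exp T E) u v <-> eqdegB x y (f u) (f v).
  split=> [/eqdeg_edge H|[/offdegP o1 /offdegP o2 h1 h2]].
    have {}H z : edeg (f u).1.1 z + edeg (f u).1.2 z + (f u).2 * (z \in e) =
      edeg (f v).1.1 z + edeg (f v).1.2 z + (f v).2 * (z \in e) by rewrite -!degE.
    split.
    - apply/offdegP => z zx; have [zV|zV] := boolP (z \in V1); last by rewrite !(edeg_out _ g1 zV).
      have zV2 : z \notin V2 by rewrite (disjointFr dV zV).
      have zy : z != y by apply: contraNneq y_notin_V1 => <-.
      by have := H z; rewrite !(edeg_out _ g2 zV2) !inE (negbTE zx) (negbTE zy) !muln0 !addn0.
    - apply/offdegP => z zy; have [zV|zV] := boolP (z \in V2); last by rewrite !(edeg_out _ g2 zV).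
      have zV1 : z \notin V1 by rewrite (disjointFl dV zV).
      have zx : z != x by apply: contraNneq x_notin_V2 => <-.
      by have := H z; rewrite !(edeg_out _ g1 zV1) !inE (negbTE zx) (negbTE zy) !muln0 !addn0.
    - by have := H x; rewrite !(edeg_out _ g2 x_notin_V2) !inE eqxx !muln1 !addn0.
    - by have := H y; rewrite !(edeg_out _ g1 y_notin_V1) !inE eqxx orbT !muln1 !add0n.
  apply/eqdeg_edge => z; rewrite !degE.
  have [->|zx] := eqVneq z x; first by rewrite !(edeg_out _ g2 x_notin_V2) !inE eqxx !muln1 !addn0.
  have [->|zy] := eqVneq z y.
    by rewrite !(edeg_out _ g1 y_notin_V1) !inE eqxx orbT !muln1 !add0n.
  by rewrite !inE (negbTE zx) (negbTE zy) !muln0 o1 // o2.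
have shP u v : share u v <-> shareB (f u) (f v).
  split=> [[j]|].
    rewrite -(s'K j); case: (s' j) => [[i|i]|[]] uv.
    - by apply: Or31; exists i; rewrite !mnmE.
    - by apply: Or32; exists i; rewrite !mnmE.
    - by apply: Or33.
  case=> [[i]|[i]|uv]; rewrite ?mnmE; first by exists (s (inl (inl i))).
    by exists (s (inl (inr i))).
  by exists (s (inr tt)).
split.
  by apply: (span_by_transport gK) => [u v|u v /shP //]; apply: eqP.
apply: (span_by_transport fK) => u v; first by rewrite eqP !gK.
by move=> uv; apply/shP; rewrite !gK.
Qed.

Lemma span_by_contracted m :
  span_by (eqdeg (@edge_exp _ (contr_E E e))) (@share #|contr_E E e|) m <->
  span_by (@eqdegC T E1 E2 x y) (@shareC T E1 E2) m.
Proof.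
have [s [[s' sK s'K] sE]] := contr_indexing.
pose f (u : 'X_{1..#|contr_E E e|}) : 'X_{1..#|E1|} * 'X_{1..#|E2|} :=
  ([multinom u (s (inl i)) | i < #|E1|], [multinom u (s (inr i)) | i < #|E2|]).
pose g (a : 'X_{1..#|E1|} * 'X_{1..#|E2|}) : 'X_{1..#|contr_E E e|} :=
  [multinom match s' j with inl i => a.1 i | inr i => a.2 i end | j < #|contr_E E e|].
have fK : cancel f g.
  move=> u; apply/mnmP => j; rewrite mnmE -[j in RHS]s'K.
  by case: (s' j) => [i|i] /=; rewrite ?mnmE.
have gK : cancel g f.
  by case=> [a b]; rewrite /f /g; congr (_, _); apply/mnmP => i; rewrite !mnmE sK.
have degE u z : edeg u z =
    \sum_(i < #|E1|) (f u).1 i * (z \in chi e @: enum_val i) +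
    \sum_(i < #|E2|) (f u).2 i * (z \in chi e @: enum_val i).
  rewrite /edeg (reindex s) /=; last by exists s' => ? _.
  by rewrite !big_sumType /=; congr (_ + _); apply: eq_bigr => i _; rewrite sE mnmE.
have degS u z : z \notin e -> edeg u (Some z) = edeg (f u).1 z + edeg (f u).2 z.
  move=> ze; rewrite degE; congr (_ + _); apply: eq_bigr => i _; by rewrite some_chi ze andbT.
have degN u : edeg u None = edeg (f u).1 x + edeg (f u).2 y.
  rewrite degE; congr (_ + _); apply: eq_bigr => i _; rewrite none_chi.
    suff /negbTE -> : y \notin enum_val i by rewrite orbF.
    by apply: contra y_notin_V1; apply: (subsetP (edge_subset g1 (enum_valP i))).
  suff /negbTE -> : x \notin enum_val i by [].
  by apply: contra x_notin_V2; apply: (subsetP (edge_subset g2 (enum_valP i))).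
have eqP u v : eqdeg (@edge_exp _ (contr_E E e)) u v <-> eqdegC x y (f u) (f v).
  split=> [/eqdeg_edge H|[/offdegP o1 /offdegP o2 h]].
    have HS z : z \notin e -> edeg (f u).1 z + edeg (f u).2 z = edeg (f v).1 z + edeg (f v).2 z.
      by move=> ze; rewrite -!degS.
    split; last by rewrite -!degN.
    - apply/offdegP => z zx; have [zV|zV] := boolP (z \in V1); last by rewrite !(edeg_out _ g1 zV).
      have zV2 : z \notin V2 by rewrite (disjointFr dV zV).
      have ze : z \notin e by rewrite !inE (negbTE zx); apply: contraNneq y_notin_V1 => <-.
      by have := HS z ze; rewrite !(edeg_out _ g2 zV2) !addn0.
    - apply/offdegP => z zy; have [zV|zV] := boolP (z \in V2); last by rewrite !(edeg_out _ g2 zV).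
      have zV1 : z \notin V1 by rewrite (disjointFl dV zV).
      have ze : z \notin e by rewrite !inE (negbTE zy) orbF; apply: contraNneq x_notin_V2 => <-.
      by have := HS z ze; rewrite !(edeg_out _ g1 zV1) !add0n.
  apply/eqdeg_edge => -[z|]; last by rewrite !degN.
  (* The type [option T] still contains [Some x] and [Some y], but no contracted edge meets them, so
     both degrees are 0. *)
  have [ze|ze] := boolP (z \in e).
    by rewrite !degE !big1 // => i _; rewrite some_chi ze andbF muln0.
  have := ze; rewrite !inE => /norP[zx zy].
  by rewrite !degS // o1 // o2.
have shP u v : share u v <-> shareC (f u) (f v).
  split=> [[j]|].
    rewrite -(s'K j); case: (s' j) => [i|i] uv.
    - by left; exists i; rewrite !mnmE.
    - by right; exists i; rewrite !mnmE.
  case=> [[i]|[i]]; rewrite ?mnmE; first by exists (s (inl i)).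
  by exists (s (inr i)).
split.
  by apply: (span_by_transport gK) => [u v|u v /shP //]; apply: eqP.
apply: (span_by_transport fK) => u v; first by rewrite eqP !gK.
by move=> uv; apply/shP; rewrite !gK.
Qed.

Lemma beta1_bridge K : beta1 K E = beta1 K (contr_E E e).
Proof.
have set0E : set0 \notin E.
  rewrite !inE -orbA; apply/or3P => -[/simple1|/simple2|/eqP/setP/(_ x)].
  - by case=> a [b [_ /setP/(_ a)]]; rewrite !inE eqxx.
  - by case=> a [b [_ /setP/(_ a)]]; rewrite !inE eqxx.
  - by rewrite !inE eqxx.
apply: eq_beta1 => // [|m].
  apply/imsetP => -[f]; rewrite inE => /andP[_ fE] /esym/eqP; rewrite imset_eq0.
  by move/eqP=> f0; rewrite f0 (negbTE set0E) in fE.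
have H := span_by_contract x y simple1 simple2 m.
by split=> [/span_by_bridge/H/span_by_contracted | /span_by_contracted/H/span_by_bridge].
Qed.

End Bridge.


Theorem theorem4p2 (K : fieldType) (T : finType)
    (V1 V2 : {set T}) (E1 E2 : {set {set T}}) (x y : T) :
  simple_graph V1 E1 -> simple_graph V2 E2 ->
  connected V1 E1 -> connected V2 E2 ->
  [disjoint V1 & V2] ->
  x \in V1 -> y \in V2 ->
  let e := [set x; y] in
  let E := E1 :|: E2 :|: [set e] in
  beta1 K E = beta1 K (contr_E E e).
Proof. by move=> g1 g2 _ _ dV xV yV; apply: beta1_bridge g1 g2 dV xV yV K. Qed.
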